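(* Let $\{x_{ij}\}_{1\le i\le n,\,1\le j\le N}$ ($N\ge2$) be random variables that are independent across $i$ and, for each fixed $i$, i.i.d. across $j$. For a bivariate function $h^*$ let $$H^*_{n,N}=\frac{1}{nN(N-1)}\sum_{i=1}^n\sum_{1\le j\ne j'\le N}h^*(x_{ij},x_{ij'}).$$ Suppose there exists $b>0$ such that $\max_{1\le i\le n,\,1\le j\ne j'\le N}|h^*(x_{ij},x_{ij'})|\le b$. Let $\theta=n^{-1}\sum_{i=1}^n\mathbb{E}h^*(x_{i1},x_{i2})$ and $\sigma^2=n^{-1}\sum_{i=1}^n\mathrm{Var}(h^*(x_{i1},x_{i2}))$. Then for all $\delta\in(0,1)$, with probability (at least) $1-\delta$, $$|H^*_{n,N}-\theta|\le2\sigma\sqrt{\frac{2\log(2/\delta)}{nN}}+\frac{16b\log(2/\delta)}{3nN}.$$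
   Context: Functions are measurable. The inner sum is over ordered pairs $(j,j')$ with $j\ne j'$; $\sigma\ge0$ is the square root of $\sigma^2$. *)

(* Defs.v *)
From mathcomp Require Import all_boot all_order all_algebra.
From mathcomp Require Import all_classical all_reals all_analysis.
Import Order.TTheory GRing.Theory Num.Theory.
Import numFieldNormedType.Exports.

Set Implicit Arguments.
Unset Strict Implicit.
Unset Printing Implicit Defensive.

Local Open Scope classical_set_scope.
Local Open Scope ring_scope.

Section defs.
Context d (Om : measurableType d) (R : realType) (P : probability Om R).

(* The product rule for the proper subfamilies is the case where some of the
   A i are setT. *)
Definition mutually_independent (I : finType) d' (E : measurableType d')
    (X : I -> Om -> E) : Prop :=
  forall A : I -> set E, (forall i, measurable (A i)) ->
    P (\bigcap_i (X i @^-1` A i)) = (\prod_i P (X i @^-1` A i))%E.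

Definition identically_distributed (I : finType) d' (E : measurableType d')
    (X : I -> {mfun Om >-> E}) : Prop :=
  forall (i i' : I) (A : set E), measurable A ->
    distribution P (X i) A = distribution P (X i') A.

Section array.
Context d' (E : measurableType d') (n N : nat).
Variables (x : 'I_n -> 'I_N -> {mfun Om >-> E}) (h : E -> E -> R).

(* N.-tuple E carries the product sigma-algebra. *)
Definition array_row (i : 'I_n) (w : Om) : N.-tuple E :=
  [tuple x i j w | j < N].

Definition Hstar (w : Om) : R :=
  (n%:R * N%:R * (N%:R - 1))^-1 *
  \sum_(i < n) \sum_(j < N) \sum_(j' < N | j != j') h (x i j w) (x i j' w).

Definition h_first_two (hN : (1 < N)%N) (i : 'I_n) (w : Om) : R :=
  h (x i (Ordinal (ltnW hN)) w) (x i (Ordinal hN) w).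

(* When h(x_ij, x_ij') is a.s. bounded the moments are finite, so
   that fine loses nothing. *)
Definition theta (hN : (1 < N)%N) : R :=
  n%:R^-1 * \sum_(i < n) fine 'E_P[h_first_two hN i].

Definition sigma2 (hN : (1 < N)%N) : R :=
  n%:R^-1 * \sum_(i < n) fine 'V_P[h_first_two hN i].

End array.
End defs.

(* Main.v *)
(* Truncating h to [-b, b] changes nothing almost surely, so h may be assumed
   bounded.  Following Hoeffding, H* is the average over all permutations s of
   the columns of the means of h(x_(i, s(2k)), x_(i, s(2k+1))), k < N/2, whose
   n floor(N/2) summands are independent.  By convexity of the exponential the
   moment generating function of H* - theta is at most the average of those of
   these sums of independent terms, and Bernstein's bound applies to each of
   them.  Since 3 floor(N/2) >= N, a Chernoff bound for h and one for -h give
   the constants of the statement, with some room to spare. *)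
From HB Require Import structures.
Require Import Defs.
From mathcomp Require Import all_boot all_order all_algebra all_fingroup.
From mathcomp Require Import all_classical all_reals all_analysis.
From mathcomp Require Import measurable_realfun simple_functions.
From mathcomp Require Import measurable_fun_approximation.
From mathcomp Require Import ring lra zify.
Import Order.TTheory GRing.Theory Num.Theory.
Import numFieldNormedType.Exports.
Local Open Scope classical_set_scope.
Local Open Scope ring_scope.

Set Implicit Arguments.
Unset Strict Implicit.
Unset Printing Implicit Defensive.

(** Independence is given as a product rule for sets, at two levels: between rows seen as tuples,
    and between the entries of one row. The moment generating function needs it for products of
    expectations. This is derived once, for independence known on a generating pi-system only, and
    used at both levels: with all measurable sets for rows, with rectangles for pairs of entries. It
    asks for factors bounded everywhere, which is why the almost sure bound is first made global.

    One exponent [l] serves all rows, so the row variances, which may differ, enter only through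
    their mean [sigma2].

    Centring replaces the bound [b] by [2 * b]. With n N / 3 summands, the usual inversion of
    Bernstein's inequality would give sqrt 6 and 4 where the statement has 2 sqrt 2 and 16 / 3; the
    difference pays for a simpler choice of [l]. *)

(** * Elementary inequalities and a count over permutations *)

Lemma ge0_of_derive_ge0 (R : realType) (f df : R -> R) :
  (forall x : R, is_derive x 1 f (df x)) -> (forall x, 0 <= x -> 0 <= df x) ->
  0 <= f 0 -> forall x, 0 <= x -> 0 <= f x.
Proof.
move=> fdf df0 f0 x x0; apply: (le_trans f0).
apply: (@ger0_derive1_ndecry _ f 0 _ _ _ _ _ _ x0) => // [y|].
- rewrite in_itv/= andbT => y0.
  by rewrite derive1E (@derive_val _ _ _ _ _ _ _ (fdf y)) df0// ltW.
- apply: continuous_subspaceT => y.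
  by apply/differentiable_continuous/derivable1_diffP; exact: ex_derive.
Qed.

(** The difference of the two sides and its first two derivatives vanish at 0, and its third
    derivative is [expR y * (2 * y)]. *)
Lemma expR_pade (R : realType) (y : R) : 0 <= y ->
  expR y * (6 - 2 * y) <= 6 + 4 * y + y ^+ 2.
Proof.
move=> y0; rewrite -subr_ge0; move: y y0.
apply: (@ge0_of_derive_ge0 _
  (fun y => 6 + 4 * y + y ^+ 2 - expR y * (6 - 2 * y))
  (fun y => 4 + 2 * y - expR y * (4 - 2 * y))).
- by move=> x; apply: is_derive_eq; rewrite /GRing.scale/=; ring.
- apply: (@ge0_of_derive_ge0 _ _ (fun y => 2 - expR y * (2 - 2 * y))).
  + by move=> x; apply: is_derive_eq; rewrite /GRing.scale/=; ring.
  + apply: (@ge0_of_derive_ge0 _ _ (fun y => expR y * (2 * y))).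
    * by move=> x; apply: is_derive_eq; rewrite /GRing.scale/=; ring.
    * by move=> x x0; rewrite mulr_ge0 ?expR_ge0// mulr_ge0.
    * by rewrite /= expR0; lra.
  + by rewrite /= expR0; lra.
- by rewrite /= expR0; lra.
Qed.

Lemma expRN_le (R : realType) (y : R) : 0 <= y ->
  expR (- y) <= 1 - y + y ^+ 2 / 2.
Proof.
move=> y0; rewrite -subr_ge0; move: y y0.
apply: (@ge0_of_derive_ge0 _
  (fun y => 1 - y + y ^+ 2 / 2 - expR (- y)) (fun y => y - 1 + expR (- y))).
- by move=> x; apply: is_derive_eq; rewrite /GRing.scale/=; field.
- by move=> x _; have := expR_ge1Dx (- x); lra.
- by rewrite /= oppr0 expR0; lra.
Qed.

(* For [0 <= y < 3] the right-hand side with [s = y] is the Pade approximant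
   [(6 + 4 y + y ^ 2) / (6 - 2 y)] of the exponential. *)
Lemma expR_le_bernstein (R : realType) (s y : R) : s < 3 -> `|y| <= s ->
  expR y <= 1 + y + y ^+ 2 / (2 * (1 - s / 3)).
Proof.
move=> s3 ys; have s0 : 0 <= s by exact: le_trans ys.
have [y0|/ltW y0] := leP 0 y.
  move: ys; rewrite ger0_norm// => ys.
  have y3 : 0 < 6 - 2 * y by lra.
  apply: (@le_trans _ _ ((6 + 4 * y + y ^+ 2) / (6 - 2 * y))).
    by rewrite ler_pdivlMr// expR_pade.
  have -> : (6 + 4 * y + y ^+ 2) / (6 - 2 * y) =
            1 + y + y ^+ 2 / (2 * (1 - y / 3)) by field; lra.
  rewrite lerD2l ler_wpM2l ?sqr_ge0// lef_pV2 ?posrE; lra.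
(* For [y <= 0] the quadratic Taylor bound suffices, since [1 - s / 3] is at most 1. *)
have := @expRN_le R (- y); rewrite opprK => /(_ _)/le_trans; apply; first lra.
rewrite sqrrN lerD2l ler_wpM2l ?sqr_ge0// lef_pV2 ?posrE; lra.
Qed.

(** The exponential lies above its tangent at the mean [a]; summed over [i], the linear terms of
    these tangent bounds cancel. *)
Lemma expR_mean_le (R : realType) (I : finType) (y : I -> R) :
  (0 < #|I|)%N ->
  expR (#|I|%:R^-1 * \sum_i y i) <= #|I|%:R^-1 * \sum_i expR (y i).
Proof.
move=> I0; set a := _ * \sum_i y i.
have I0' : (0 : R) < #|I|%:R by rewrite ltr0n.
rewrite ler_pdivlMl//.
have -> : #|I|%:R * expR a = \sum_i (expR a * (1 + (y i - a))).
  rewrite -mulr_sumr big_split/= sumrB !sumr_const -/(#|I|) -mulr_natr.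
  have -> : \sum_i y i = #|I|%:R * a by rewrite mulVKf// gt_eqF.
  by rewrite -mulr_natl; ring.
apply: ler_sum => i _.
rewrite -[in leRHS](subrK a (y i)) expRD [leRHS]mulrC ler_wpM2l ?expR_ge0//.
exact: expR_ge1Dx.
Qed.

(** Permutations act transitively on ordered pairs of distinct points, so the sum over [s] is the
    same for all such pairs. Its total over all pairs is then computed by exchanging sums, as each
    [s] only reindexes the off-diagonal sum. *)
Lemma sum_perm_pair (R : comPzRingType) (T : finType) (F : T -> T -> R)
    (a b : T) : a != b ->
  (#|T| * #|T|.-1)%:R * (\sum_(s : {perm T}) F (s a) (s b)) =
  (#|T| `!)%:R * (\sum_j \sum_(j' | j != j') F j j').
Proof.
move=> ab.
pose G a b := \sum_(s : {perm T}) F (s a) (s b).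
have Gconst c e : c != e -> G c e = G a b.
  move=> ce.
  suff [t [ta tb]] : exists t : {perm T}, t a = c /\ t b = e.
    rewrite /G (reindex_inj (mulgI t^-1%g)); apply: eq_bigr => s _.
    by rewrite -ta -tb !permM !permK.
  (* The left factor acts first and sends [a] to [c]; the second sends the image of [b] to [e] and
     fixes [c], which differs from both. *)
  exists (tperm a c * tperm (tperm a c b) e)%g; rewrite !permM !tpermL.
  split => //; rewrite tpermD 1?eq_sym//.
  by rewrite -[X in X != _](tpermL a c) (inj_eq perm_inj).
transitivity (\sum_j \sum_(j' | j != j') G j j').
  under [RHS]eq_bigr => j _.
    rewrite (eq_bigr (fun=> G a b)); last by move=> j' /Gconst.
    rewrite sumr_const (_ : #|_| = #|T|.-1); first over.
    by rewrite -(cardC1 j); apply: eq_card => k; rewrite !inE eq_sym.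
  by rewrite sumr_const -mulrnA mulr_natl mulnC.
have perm_invariant (s : {perm T}) : \sum_j \sum_(j' | j != j') F (s j) (s j') =
                                     \sum_j \sum_(j' | j != j') F j j'.
  rewrite [RHS](reindex_inj (@perm_inj _ s)); apply: eq_bigr => j _.
  rewrite [RHS](reindex_inj (@perm_inj _ s)); apply: eq_bigl => j'.
  by rewrite (inj_eq (@perm_inj _ s)).
rewrite /G; under eq_bigr => j _ do rewrite exchange_big/=.
rewrite exchange_big/=; under eq_bigr => s _ do rewrite perm_invariant.
rewrite sumr_const mulr_natl; congr (_ *+ _).
rewrite -(cardsT T) -card_perm; apply: eq_card => s.
apply/esym; rewrite unfold_in.
by apply/fintype.subsetP => ? _; rewrite finset.in_setT.
Qed.

(* To be read with [c] the bound and [s ^ 2] the variance of the summands and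
   [r ^ 2] = L / (n N).  The usual optimal [l] for Bernstein's inequality
   degenerates to [l * c = 3] when [s = 0]; this choice does not, at the
   price of constants above the optimal ones.  14 / 5 is at most 2 sqrt 2. *)
Lemma bernstein_exponent_ge (R : realFieldType) (c r s t : R) :
  0 < c -> 0 < r -> 0 <= s -> 14 / 5 * s * r + 8 / 3 * c * r ^+ 2 <= t ->
  let l := r / (8 / 9 * c * r + 2 / 5 * s) in
  [/\ 0 < l, l * c < 3 &
      3 * r ^+ 2 <= l * t - l ^+ 2 * s ^+ 2 / (2 * (1 - l * c / 3))].
Proof.
move=> c0 r0 s0 tge l.
have u0 : 0 < c * r by rewrite mulr_gt0.
pose D := 8 / 9 * (c * r) + 2 / 5 * s.
(* [F / D] is [1 - l * c / 3], so the variance term becomes [r ^+ 2 / D] times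
   [s ^+ 2 / (2 * F)]. *)
pose F := 5 / 9 * (c * r) + 2 / 5 * s.
have D0 : 0 < D by rewrite /D; lra.
have F0 : 0 < F by rewrite /F; lra.
have lE : l = r / D by rewrite /l /D mulrA.
have l0 : 0 < l by rewrite lE divr_gt0.
split => //; first by rewrite lE mulrAC ltr_pdivrMr// /D; lra.
have FD : F = D - c * r / 3 by rewrite /F /D; field.
have -> : 1 - l * c / 3 = F / D by rewrite lE FD; field; rewrite gt_eqF.
(* 8 / 5 is what the last comparison leaves for this term: [3 * D] equals
   [8 / 3 * (c * r) + (14 / 5 - 8 / 5) * s]. *)
have sF : s ^+ 2 / (2 * F) <= 8 / 5 * s.
  rewrite ler_pdivrMr ?mulr_gt0// expr2 -[leRHS]mulrA [leRHS]mulrCA.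
  by rewrite ler_wpM2l// /F; lra.
apply: (@le_trans _ _ (l * (14 / 5 * s * r + 8 / 3 * c * r ^+ 2) -
    l ^+ 2 * s ^+ 2 / (2 * (F / D)))); last first.
  by rewrite lerD2r ler_wpM2l// ltW.
have -> : l * (14 / 5 * s * r + 8 / 3 * c * r ^+ 2) -
    l ^+ 2 * s ^+ 2 / (2 * (F / D)) =
    r ^+ 2 / D * (14 / 5 * s + 8 / 3 * (c * r) - s ^+ 2 / (2 * F)).
  by rewrite lE; field; rewrite !gt_eqF.
rewrite [leRHS]mulrAC ler_pdivlMr// [leLHS]mulrAC [leLHS]mulrC.
by rewrite ler_wpM2l ?sqr_ge0// /D; lra.
Qed.

Lemma lee_prod (R : realDomainType) (J : finType) (f g : J -> \bar R) :
  (forall j, 0 <= f j <= g j)%E -> (\prod_j f j <= \prod_j g j)%E.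
Proof.
move=> fg.
suff : (0 <= \prod_j f j <= \prod_j g j)%E by case/andP.
elim/big_ind2 : _ => //; first by rewrite lee01 lexx.
move=> u v u' v' /andP[u0 uv] /andP[u'0 uv'].
by rewrite mule_ge0//= lee_pmul.
Qed.

(** * Laws of a random element under a weight *)

Section weighted_law.
Local Open Scope ereal_scope.
Context d d' (Om : measurableType d) (T : measurableType d') (R : realType).
Variables (mu : {measure set Om -> \bar R}) (Z : Om -> T) (W : Om -> R).
Hypotheses (mZ : measurable_fun setT Z) (mW : measurable_fun setT W).
Hypothesis W0 : forall w, (0 <= W w)%R.

(* The proof arguments are there for the measure instance to be inferred. *)
Definition weighted_law of measurable_fun setT Z & measurable_fun setT W &
    (forall w, (0 <= W w)%R) :=
  fun A : set T => \int[mu]_(w in Z @^-1` A) (W w)%:E.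

Let nu := weighted_law mZ mW W0.

Let mZA A : measurable A -> measurable (Z @^-1` A).
Proof. by move=> mA; rewrite -[_ @^-1` _]setTI; exact: mZ. Qed.

Let mWE D : measurable_fun D (fun w => (W w)%:E).
Proof. by apply/measurable_EFinP; exact: measurable_funTS. Qed.

Let nu0 : nu set0 = 0.
Proof. by rewrite /nu /weighted_law preimage_set0 integral_set0. Qed.

Let nu_ge0 A : 0 <= nu A.
Proof. by apply: integral_ge0 => w _; rewrite lee_fin. Qed.

Let nu_sigma_additive : semi_sigma_additive nu.
Proof.
move=> F mF tF mUF; rewrite /nu /weighted_law preimage_bigcup.
rewrite ge0_integral_bigcup//.
- apply: is_cvg_nneseries => n _ _.
  by apply: integral_ge0 => w _; rewrite lee_fin.
- by move=> n; exact: mZA.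
- by move=> w _; rewrite lee_fin.
- apply/trivIsetP => i j _ _ ij; rewrite -preimage_setI.
  by move/trivIsetP : tF => -> //; rewrite preimage_set0.
Qed.

HB.instance Definition _ :=
  isMeasure.Build _ _ _ nu nu0 nu_ge0 nu_sigma_additive.

Import HBNNSimple.

(** Change of variables. Both sides are monotone limits along simple functions below [f], and on a
    level set of such a function the identity is the definition of [weighted_law]. *)
Lemma ge0_integral_weighted_law (f : T -> R) :
  measurable_fun setT f -> (forall y, (0 <= f y)%R) ->
  \int[nu]_y (f y)%:E = \int[mu]_w (W w * f (Z w))%:E.
Proof.
move=> mf f0.
have mfE : measurable_fun setT (EFin \o f) by exact/measurable_EFinP.
pose f_ := nnsfun_approx measurableT mfE.
have f_cvg y : (f_ n y)%:E @[n --> \oo] --> (f y)%:E.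
  by apply: (@cvg_nnsfun_approx _ _ _ _ measurableT _ mfE) => // *;
     rewrite lee_fin.
have f_nd y : nondecreasing_seq (fun n => f_ n y).
  by move=> m n mn; exact/lefP/nd_nnsfun_approx.
have mf_Z n : measurable_fun setT (fun w => f_ n (Z w)).
  exact: measurableT_comp.
transitivity (limn (fun n => \int[nu]_y (f_ n y)%:E)).
  rewrite -monotone_convergence//.
  - by apply: eq_integral => y _; apply/esym/cvg_lim.
  - by move=> n; exact/measurable_EFinP/measurable_funP.
  - by move=> n y _; rewrite lee_fin.
  - by move=> y _ m n mn; rewrite lee_fin f_nd.
transitivity (limn (fun n => \int[mu]_w (W w * f_ n (Z w))%:E)); last first.
  rewrite -monotone_convergence//.
  - apply: eq_integral => w _; apply/cvg_lim => //=.
    under eq_fun do rewrite EFinM.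
    by rewrite EFinM; apply: cvgeZl => //; exact: f_cvg.
  - by move=> n; apply/measurable_EFinP/measurable_funM.
  - by move=> n w _; rewrite lee_fin mulr_ge0.
  - by move=> w _ m n mn; rewrite lee_fin ler_wpM2l// f_nd.
(* At a fixed [n] both integrals split over the finitely many values of [f_ n]. *)
congr (limn _); apply/funext => n.
under [in LHS]eq_integral do rewrite fimfunE -fsumEFin//.
rewrite ge0_integral_fsum//; last 2 first.
- by move=> y; exact/measurable_EFinP/measurable_funM.
- by move=> y x _; rewrite nnfun_muleindic_ge0.
transitivity (\sum_(k \in range (f_ n))
    \int[mu]_w (k * (W w * \1_(f_ n @^-1` [set k]) (Z w)))%:E); last first.
  rewrite -ge0_integral_fsum//; last 2 first.
  - move=> k; apply/measurable_EFinP; apply: measurable_funM => //.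
    by apply: measurable_funM => //; apply: (measurableT_comp _ mZ).
  - move=> k w _; rewrite mulrCA EFinM mule_ge0 ?lee_fin//.
    exact: nnfun_muleindic_ge0.
  apply: eq_integral => w _; rewrite fsumEFin//; congr EFin.
  rewrite [in RHS]fimfunE mulr_fsumr//.
  by apply: eq_fsbigr => k _; rewrite mulrCA.
apply: eq_fsbigr => k kf.
have k0 : (0 <= k)%R by move: kf; rewrite inE => -[y _ <-].
rewrite integralZl_indic_nnsfun// integral_indic//= setIT.
under [RHS]eq_integral do rewrite EFinM.
rewrite ge0_integralZl//; last 2 first.
- apply/measurable_EFinP; apply: measurable_funM => //.
  by apply: (measurableT_comp _ mZ).
- by move=> w _; rewrite lee_fin mulr_ge0.
congr (_ * _); rewrite /nu /weighted_law integral_mkcond.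
apply: eq_integral => w _; rewrite patchE indicE.
case: ifPn => [/set_mem wk|/negP wk]; first by rewrite mem_set// mulr1.
by rewrite memNset ?mulr0// => /mem_set.
Qed.

End weighted_law.

(** * From a pi-system to expectations of products *)

Section pi_system.
Local Open Scope ereal_scope.
Context d d' (Om : measurableType d) (T : measurableType d') (R : realType).
Variables (P : probability Om R) (G : set (set T)).
Hypotheses (mG : measurable = <<s G >>) (GI : setI_closed G) (GT : G setT).

Let Gm A : G A -> measurable A.
Proof. by rewrite mG; exact: sub_sigma_algebra. Qed.

(** Each side integrates [f] against a weighted law on [T]. The two laws agree on the generating
    pi-system [G] and are finite, because [W1] is bounded, so they are equal. *)
Lemma eq_weighted_expectation (Z1 Z2 : Om -> T) (W1 W2 : Om -> R) (M : R)
    (f : T -> R) :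
  measurable_fun setT Z1 -> measurable_fun setT Z2 ->
  measurable_fun setT W1 -> measurable_fun setT W2 ->
  (forall w, (0 <= W1 w <= M)%R) -> (forall w, (0 <= W2 w)%R) ->
  (forall A, G A -> \int[P]_w (W1 w * \1_A (Z1 w))%:E =
                    \int[P]_w (W2 w * \1_A (Z2 w))%:E) ->
  measurable_fun setT f -> (forall y, (0 <= f y)%R) ->
  \int[P]_w (W1 w * f (Z1 w))%:E = \int[P]_w (W2 w * f (Z2 w))%:E.
Proof.
move=> mZ1 mZ2 mW1 mW2 W1M W20 eqG mf f0.
have W10 w : (0 <= W1 w)%R by case/andP: (W1M w).
have lawE (Z : Om -> T) (W : Om -> R) (mZ : measurable_fun setT Z)
    (mW : measurable_fun setT W) (W0 : forall w, (0 <= W w)%R) A :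
    weighted_law P mZ mW W0 A = \int[P]_w (W w * \1_A (Z w))%:E.
  rewrite /weighted_law integral_mkcond; apply: eq_integral => w _.
  rewrite patchE indicE; case: ifPn => [/set_mem wA|/negP wA].
    by rewrite mem_set// mulr1.
  by rewrite memNset ?mulr0// => /mem_set.
rewrite -(ge0_integral_weighted_law P mZ1 mW1 W10)//.
rewrite -(ge0_integral_weighted_law P mZ2 mW2 W20)//.
apply: eq_measure_integral => A mA _.
apply: (measure_unique G (fun=> setT)) => //.
- by rewrite bigcup_const//; exists 0%N.
- by move=> B GB; rewrite /= !lawE eqG.
- move=> _; rewrite /= lawE; apply: (@le_lt_trans _ _ (\int[P]_w M%:E)).
    apply: ge0_le_integral => //.
    + by move=> w _; rewrite lee_fin indicT mulr1.
    + apply/measurable_EFinP; apply: measurable_funM => //.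
      by rewrite indicT.
    + by move=> w _; rewrite lee_fin indicT mulr1; case/andP: (W1M w).
  by rewrite integral_cst//= probability_setT mule1 ltry.
Qed.

(** The product rule is demanded on sets of [G] only, so that for pairs it can be checked on
    rectangles. *)
Lemma expectation_prod_indep (J : finType) (Z : J -> Om -> T) (f : J -> T -> R)
    (M : R) :
  (forall i, measurable_fun setT (Z i)) ->
  (forall A : J -> set T, (forall i, G (A i)) ->
    P (\bigcap_i (Z i @^-1` A i)) = \prod_i P (Z i @^-1` A i)) ->
  (forall i, measurable_fun setT (f i)) ->
  (forall i y, (0 <= f i y <= M)%R) ->
  \int[P]_w (\prod_i f i (Z i w))%:E = \prod_i \int[P]_w (f i (Z i w))%:E.
Proof.
move=> mZ indepZ mf fM.
(* The indicators of members of the pi-system are replaced by the functions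
   [f i] one index at a time, the other factors acting as a weight. *)
pose mix (K : {set J}) (A : J -> set T) i : T -> R :=
  if i \in K then f i else \1_(A i).
have mmix K A i : G (A i) -> measurable_fun setT (mix K A i).
  by move=> /Gm mA; rewrite /mix; case: ifP => // _; exact: measurable_indic.
(* An index is taken as argument since [M] may be negative when [J] is empty. *)
have M0 : J -> (0 <= M)%R.
  by move=> i; have /andP[f0 fM'] := fM i (Z i point); exact: le_trans fM'.
have mix0 K A i y : (0 <= mix K A i y)%R.
  rewrite /mix; case: ifP => _; first by case/andP: (fM i y).
  by rewrite indicE.
(* [M + 1] bounds both kinds of factor, functions and indicators. *)
have mixM K A i y : (mix K A i y <= M + 1)%R.
  rewrite /mix; case: ifP => _.
    by case/andP: (fM i y) => _ /le_trans; apply; rewrite lerDl.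
  by rewrite indicE -[leLHS]add0r lerD ?M0// lern1 leq_b1.
suff main (K : {set J}) A : (forall i, G (A i)) ->
    \int[P]_w (\prod_i mix K A i (Z i w))%:E =
    \prod_i \int[P]_w (mix K A i (Z i w))%:E.
  have := main [set: J]%SET (fun=> setT) (fun=> GT).
  have mixT i : mix [set: J]%SET (fun=> setT) i = f i.
    by rewrite /mix finset.in_setT.
  under eq_integral do under eq_bigr do rewrite mixT.
  by under eq_bigr do under eq_integral do rewrite mixT.
have mixP L B i0 w : (\prod_i mix L B i (Z i w))%R =
    (mix L B i0 (Z i0 w) * \prod_(i | i != i0) mix L B i (Z i w))%R.
  by rewrite (bigD1 i0).
have intE i : (forall B, G B -> \int[P]_w (\1_B (Z i w))%:E = P (Z i @^-1` B)).
  move=> B GB; rewrite (_ : (fun w => _) = EFin \o \1_(Z i @^-1` B))//.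
  rewrite integral_indic ?setIT//.
  by rewrite -[_ @^-1` _]setTI; apply: mZ => //; exact: Gm.
move: {2}#|K| (leqnn #|K|) => k; elim: k K A => [|k IH] K A Kk GA.
  have K0 : K = finset.set0 by apply/cards0_eq/eqP; rewrite -leqn0.
  have mix1 i : mix K A i = \1_(A i) by rewrite /mix K0 finset.in_set0.
  under eq_bigr do under eq_integral do rewrite mix1.
  under eq_bigr do rewrite intE//.
  rewrite -indepZ//.
  transitivity (\int[P]_w (\1_(\bigcap_i (Z i @^-1` A i)) w)%:E); last first.
    rewrite integral_indic ?setIT//.
    apply: fin_bigcap_measurable => // i _.
    by rewrite -[_ @^-1` _]setTI; apply: mZ => //; exact: Gm.
  apply: eq_integral => w _; congr EFin.
  under eq_bigr do rewrite mix1 indicE.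
  rewrite indicE; have [/forallP ZA|] := boolP [forall i, Z i w \in A i].
    rewrite big1 => [|i _]; last by rewrite ZA.
    by rewrite mem_set// => i _; exact/set_mem/ZA.
  rewrite negb_forall => /existsP[i ZAi].
  rewrite (bigD1 i)//= (negbTE ZAi) mul0r memNset// => /(_ i I) ZAi'.
  by move/negP: ZAi; apply; exact/mem_set.
have mix_fin i : \int[P]_w (mix K A i (Z i w))%:E \is a fin_num.
  rewrite ge0_fin_numE; last by apply: integral_ge0 => w _; rewrite lee_fin.
  apply: (@le_lt_trans _ _ (\int[P]_w (M + 1)%:E)).
    apply: ge0_le_integral => //.
    + by move=> w _; rewrite lee_fin.
    + by apply/measurable_EFinP; apply: measurableT_comp => //; exact: mmix.
    + by move=> w _; rewrite lee_fin.
  by rewrite integral_cst//= probability_setT mule1 ltry.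
have [->|[i0 iK]] := finset.set_0Vmem K.
  by apply: IH => //; rewrite finset.cards0.
(* With [B] at [i0], the induction hypothesis for [K] without [i0] gives the product formula in
   which the factor at [i0] is the indicator of [B]. *)
pose A' B i := if i == i0 then B else A i.
have mixA' B i : i != i0 -> mix (K :\ i0)%SET (A' B) i = mix K A i.
  by move=> ii0; rewrite /mix finset.in_setD1 ii0/= /A' (negbTE ii0).
have mixA'0 B : mix (K :\ i0)%SET (A' B) i0 = \1_B.
  by rewrite /mix finset.setD11 /A' eqxx.
have mixi0 : mix K A i0 = f i0 by rewrite /mix iK.
pose c := (\prod_(i | i != i0) fine (\int[P]_w (mix K A i (Z i w))%:E))%R.
have cE : c%:E = \prod_(i | i != i0) \int[P]_w (mix K A i (Z i w))%:E.
  by rewrite -prodEFin; apply: eq_bigr => i _; rewrite fineK.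
rewrite (bigD1 i0)//= -cE mixi0.
transitivity
    (\int[P]_w ((\prod_(i | i != i0) mix K A i (Z i w)) * f i0 (Z i0 w))%:E).
  by apply: eq_integral => w _; rewrite (mixP _ _ i0) mixi0 mulrC.
have c0 : (0 <= c)%R.
  apply: prodr_ge0 => i _; apply/fine_ge0/integral_ge0 => w _.
  by rewrite lee_fin.
have mW : measurable_fun setT
    (fun w => \prod_(i | i != i0) mix K A i (Z i w))%R.
  under eq_fun do rewrite -big_filter.
  apply: measurable_prod => i _; apply: measurableT_comp => //; exact: mmix.
transitivity (\int[P]_w (c * f i0 (Z i0 w))%:E); last first.
  rewrite muleC -ge0_integralZl//=.
  - by apply/measurable_EFinP; exact: measurableT_comp.
  - by move=> w _; rewrite lee_fin; case/andP: (fM i0 (Z i0 w)).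
(* Both sides are now weighted expectations of [f i0] along [Z i0]: on the left the weight is the
   product of the other factors, on the right it is the constant [c]. *)
apply: (@eq_weighted_expectation _ _ _ (cst c)
  ((M + 1) ^+ #|[pred i | i != i0]|)) => //.
- move=> w; rewrite prodr_ge0//= -prodr_const ler_prod// => i _.
  by rewrite mix0 mixM.
- move=> B GB.
  transitivity (\int[P]_w (\prod_i mix (K :\ i0)%SET (A' B) i (Z i w))%:E).
    apply: eq_integral => w _; rewrite (mixP _ _ i0) mixA'0 mulrC.
    congr (_ * _)%:E.
    by apply: eq_bigr => i ii0; rewrite mixA'.
  rewrite IH; last 2 first.
  + by rewrite -ltnS (leq_trans _ Kk)// [leqRHS](finset.cardsD1 i0) iK.
  + by move=> i; rewrite /A'; case: ifP.
  rewrite (bigD1 i0)//= mixA'0 muleC.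
  under eq_bigr do rewrite mixA'//.
  rewrite -cE -ge0_integralZl//=.
  + apply/measurable_EFinP; apply: measurableT_comp => //.
    exact/measurable_indic/Gm.
- by move=> y; case/andP: (fM i0 y).
Qed.

End pi_system.

(** * Disjoint pairs of independent variables *)

Section pairs.
Local Open Scope ereal_scope.
Context d d' (Om : measurableType d) (E : measurableType d') (R : realType).
Variable P : probability Om R.

Definition rectangles : set (set (E * E)) :=
  [set A `*` B | A in measurable & B in measurable].

Lemma measurable_rectangles : measurable = <<s rectangles >>.
Proof. exact: measurable_prod_measurableType. Qed.

Lemma setI_closed_rectangles : setI_closed rectangles.
Proof.
move=> _ _ [A mA [B mB <-]] [C mC [D mD <-]].
exists (A `&` C); first exact: measurableI.
by exists (B `&` D); [exact: measurableI|rewrite setXI].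
Qed.

Lemma setT_rectangles : rectangles setT.
Proof. by exists setT => //; exists setT => //; rewrite setXTT. Qed.

Lemma mutually_independent_reindex (J K : finType) (X : J -> Om -> E)
    (c : K -> J) : injective c ->
  mutually_independent P X -> mutually_independent P (X \o c).
Proof.
move=> cI indepX A mA.
(* Intersecting over the fibre of [c] yields [A k] at [c k], by injectivity, and the whole space off
   the image of [c]. *)
pose C j := \bigcap_(k in [set k | c k = j]) A k.
have Cc k : C (c k) = A k.
  by apply/seteqP; split => y; [exact|move=> Ay k' /cI ->].
have := indepX C; rewrite (_ : \bigcap_i _ = \bigcap_k ((X \o c) k @^-1` A k)).
  move=> ->; last by move=> j; apply: fin_bigcap_measurable.
  rewrite (bigID (mem (c @: [set: K])%SET))/= [X in _ * X]big1 ?mule1.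
    rewrite big_imset//=; last by move=> ? ? _ _; exact: cI.
    by apply: eq_big => [k|k _]; rewrite ?finset.in_setT//= Cc.
  move=> j jK; rewrite (_ : C j = setT) ?preimage_setT ?probability_setT//.
  by apply/seteqP; split => // y _ k kj; move: jK; rewrite -kj finset.imset_f.
apply/seteqP; split => w AXw.
  by move=> k _; have := AXw (c k) Logic.I; rewrite /= Cc.
by move=> j _ k <-; exact: AXw.
Qed.

Lemma measurable_pair (x y : {mfun Om >-> E}) :
  measurable_fun setT (fun w => (x w, y w)).
Proof. by apply: measurable_fun_pair. Qed.

Lemma probability_rectangle (J : finType) (X : J -> Om -> E) (a b : J)
    (A B : set E) : a != b -> mutually_independent P X ->
  measurable A -> measurable B ->
  P ((fun w => (X a w, X b w)) @^-1` (A `*` B)) =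
  P (X a @^-1` A) * P (X b @^-1` B).
Proof.
move=> ab indepX mA mB.
pose c (i : bool) := if i then a else b.
have cI : injective c.
  by move=> [] [] // /eqP; rewrite /c ?(negbTE ab)// eq_sym (negbTE ab).
have := mutually_independent_reindex cI indepX.
move=> /(_ (fun i => if i then A else B)); rewrite big_bool/= => <-; last first.
  by case.
congr (P _); apply/seteqP; split => w /=; first by move=> [Aw Bw] [].
by move=> AB; split; [exact: (AB true)|exact: (AB false)].
Qed.

(** On rectangles an event about pairs is an event about separate variables, all distinct and
    indexed by [K + K]. Independence is used for this whole family and, to regroup the factors,
    within each pair. *)
Lemma pairs_independent (J K : finType) (X : J -> Om -> E) (a b : K -> J)
    (A : K -> set (E * E)) :
  injective a -> injective b -> (forall k l, a k != b l) ->
  mutually_independent P X -> (forall k, rectangles (A k)) ->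
  P (\bigcap_k ((fun w => (X (a k) w, X (b k) w)) @^-1` A k)) =
  \prod_k P ((fun w => (X (a k) w, X (b k) w)) @^-1` A k).
Proof.
move=> aI bI ab indepX rA.
have /choice[UV UVE] : forall k, exists p : set E * set E,
    [/\ measurable p.1, measurable p.2 & A k = p.1 `*` p.2].
  by move=> k; have [U mU [V mV <-]] := rA k; exists (U, V).
under eq_bigr => k _.
  have [mU mV ->] := UVE k.
  rewrite (probability_rectangle _ indepX)//.
  over.
pose c (i : K + K) := match i with inl k => a k | inr k => b k end.
have cI : injective c.
  move=> [k|k] [l|l] //= => [/aI ->|/eqP|/eqP|/bI ->]//.
    by rewrite (negbTE (ab _ _)).
  by rewrite eq_sym (negbTE (ab _ _)).
have := mutually_independent_reindex cI indepX.
move=> /(_ (fun i => match i with inl k => (UV k).1 | inr k => (UV k).2 end)).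
rewrite big_sumType/= -big_split/= => <-; last first.
  by move=> [k|k]; have [] := UVE k.
congr (P _); apply/seteqP; split => w /=.
  by move=> AX [k|k] _; have := AX k Logic.I; have [_ _ ->] := UVE k; case.
move=> AX k _; have [_ _ ->] := UVE k.
by split; [exact: (AX (inl k))|exact: (AX (inr k))].
Qed.

Lemma expectation_prod_pairs (J K : finType) (x : J -> {mfun Om >-> E})
    (a b : K -> J) (f : K -> E * E -> R) (M : R) :
  injective a -> injective b -> (forall k l, a k != b l) ->
  mutually_independent P x ->
  (forall k, measurable_fun setT (f k)) ->
  (forall k z, (0 <= f k z <= M)%R) ->
  \int[P]_w (\prod_k f k (x (a k) w, x (b k) w))%:E =
  \prod_k \int[P]_w (f k (x (a k) w, x (b k) w))%:E.
Proof.
move=> aI bI ab indepx mf fM.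
apply: (@expectation_prod_indep _ _ _ _ _ P _ measurable_rectangles
  setI_closed_rectangles setT_rectangles _
  (fun k w => (x (a k) w, x (b k) w)) f M) => //.
- by move=> k; exact: measurable_pair.
- by move=> A rA; apply: (@pairs_independent _ _ x).
Qed.

(** On a rectangle the law of a pair of distinct entries is the product of the marginals, which are
    all equal. This brings any permuted pair of columns back to the first two. *)
Lemma eq_expectation_pair (J : finType) (x : J -> {mfun Om >-> E})
    (a b c e : J) (f : E * E -> R) :
  a != b -> c != e -> mutually_independent P x ->
  identically_distributed P x ->
  measurable_fun setT f -> (forall z, (0 <= f z)%R) ->
  \int[P]_w (f (x a w, x b w))%:E = \int[P]_w (f (x c w, x e w))%:E.
Proof.
move=> ab ce indepx idx mf f0.
have mul1 (g : Om -> R) : \int[P]_w (g w)%:E = \int[P]_w (cst 1%R w * g w)%:E.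
  by apply: eq_integral => w _; rewrite mul1r.
have indE (g : Om -> E * E) A : measurable_fun setT g -> measurable A ->
    \int[P]_w (\1_A (g w))%:E = P (g @^-1` A).
  move=> mg mA; rewrite (_ : (fun w => _) = EFin \o \1_(g @^-1` A))//.
  by rewrite integral_indic ?setIT// -[_ @^-1` _]setTI; exact: mg.
rewrite mul1 [RHS]mul1.
apply: (@eq_weighted_expectation _ _ _ _ _ P _ measurable_rectangles
  setI_closed_rectangles setT_rectangles (fun w => (x a w, x b w))
  (fun w => (x c w, x e w)) (cst 1%R) (cst 1%R) 1%R) => //.
- exact: measurable_pair.
- exact: measurable_pair.
- by move=> w; rewrite /= ler01 lexx.
- move=> _ [A mA [B mB <-]].
  have mAB : measurable (A `*` B) by exact: measurableX.
  rewrite -!mul1 !indE//; try exact: measurable_pair.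
  rewrite !(@probability_rectangle _ x)//.
  by congr (_ * _); exact: idx.
Qed.

End pairs.

(** * Moment generating function of one bounded variable *)

Section bounded_variable.
Local Open Scope ereal_scope.
Context d (Om : measurableType d) (R : realType) (P : probability Om R).

Lemma Lfun1_bounded (Y : Om -> R) (b : R) : measurable_fun setT Y ->
  (forall w, `|Y w| <= b)%R -> Y \in Lfun P 1.
Proof.
move=> mY Yb; apply/Lfun1_integrable.
apply: measurable_bounded_integrable => //.
  by rewrite /= probability_setT ltry.
exists b; split; first exact: num_real.
by move=> M bM w _ /=; rewrite (le_trans (Yb w))// ltW.
Qed.

Lemma norm_expectation_le (Y : Om -> R) (b : R) : measurable_fun setT Y ->
  (forall w, `|Y w| <= b)%R -> (`|fine 'E_P[Y]| <= b)%R.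
Proof.
move=> mY Yb; have /Lfun1_integrable iY := Lfun1_bounded mY Yb.
rewrite unlock; apply: (le_trans (le_normr_Rintegral _ iY)) => //.
have -> : b = Rintegral P setT (cst b).
  by rewrite Rintegral_cst//= probability_setT mulr1.
apply: le_Rintegral => //; first exact: integrable_norm.
by apply/Lfun1_integrable/Lfun_cst.
Qed.

(** The centred variable is bounded by [2 * b]. In the quadratic majorant of its exponential the
    linear term has mean zero and the square gives the variance; then 1 + u is at most exp u. *)
Lemma bernstein_mgf (Y : Om -> R) (b l : R) : measurable_fun setT Y ->
  (forall w, `|Y w| <= b)%R -> (0 <= l)%R -> (l * (2 * b) < 3)%R ->
  \int[P]_w (expR (l * (Y w - fine 'E_P[Y])))%:E <=
  (expR (l ^+ 2 * fine 'V_P[Y] / (2 * (1 - l * (2 * b) / 3))))%:E.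
Proof.
move=> mY Yb l0 lb.
set K := (2 * _)%R; set t := fine 'E_P[Y].
have tb : (`|t| <= b)%R by exact: norm_expectation_le.
pose D : Om -> R := (Y \- cst t)%R.
have mD : measurable_fun setT D by exact: measurable_funB.
have Db w : (`|D w| <= 2 * b)%R.
  by rewrite (le_trans (ler_normB _ _))//= mulr_natl mulr2n lerD.
have D1 : D \in Lfun P 1 by exact: Lfun1_bounded Db.
have DD1 : (D * D)%R \in Lfun P 1.
  apply: (@Lfun1_bounded _ ((2 * b) * (2 * b))%R); first exact: measurable_funM.
  by move=> w; rewrite normrM ler_pM.
have Y1 : Y \in Lfun P 1 by exact: Lfun1_bounded Yb.
have ED : 'E_P[D] = 0.
  rewrite expectationB ?Lfun_cst// expectation_cst /t fineK ?subee//;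
  exact: expectation_fin_num.
have EDD : 'E_P[(D * D)%R] = (fine 'V_P[Y])%:E.
  rewrite /variance covariance.unlock -/t fineK//.
  exact: (expectation_fin_num DD1).
apply: (@le_trans _ _
    'E_P[cst 1%R \+ l \o* D \+ (l ^+ 2 / K) \o* (D * D)]%R).
  rewrite expectation.unlock; apply: ge0_le_integral => //.
  - apply/measurable_EFinP; apply: measurableT_comp => //.
    exact: measurable_funM.
  - apply/measurable_EFinP; apply: measurable_funD.
      by apply: measurable_funD => //; exact: measurable_funM.
    by apply: measurable_funM => //; exact: measurable_funM.
  - move=> w _; rewrite lee_fin.
    have := @expR_le_bernstein R _ (l * D w) lb.
    rewrite normrM ger0_norm// ler_wpM2l// => /(_ isT) /le_trans; apply.
    rewrite -[leRHS]/(1 + D w * l + D w * D w * (l ^+ 2 / K))%R.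
    by rewrite le_eqVlt; apply/orP; left; apply/eqP; ring.
rewrite expectationD ?rpredD ?Lfun_scale ?Lfun_cst//.
rewrite expectationD ?Lfun_scale ?Lfun_cst// !expectationZl//.
rewrite ED EDD mule0 adde0.
rewrite expectation_cst -EFinM -EFinD lee_fin.
by rewrite (le_trans (expR_ge1Dx _))// ler_expR mulrAC.
Qed.

End bounded_variable.

(** * The statistic as an average over permutations *)

(** By [sum_perm_pair] each position [(i, k)], averaged over [s], yields the mean of [h] over all
    ordered pairs of columns of row [i], whatever [k] is. *)
Lemma Hstar_perm_mean (R : realType) (d d' : measure_display)
    (Om : measurableType d) (E : measurableType d') (n N m : nat)
    (x : 'I_n -> 'I_N -> {mfun Om >-> E}) (h : E -> E -> R)
    (a b : 'I_m -> 'I_N) (w : Om) :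
  (0 < n)%N -> (1 < N)%N -> (forall k, a k != b k) ->
  n%:R * m%:R * Hstar x h w = #|{perm 'I_N}|%:R^-1 *
    \sum_(s : {perm 'I_N}) \sum_i \sum_k h (x i (s (a k)) w) (x i (s (b k)) w).
Proof.
move=> n0 N1 ab.
have N0 : (N%:R : R) != 0 by rewrite pnatr_eq0 -lt0n ltnW.
have N1' : (N%:R - 1 : R) != 0 by rewrite subr_eq0 pnatr_eq1 gtn_eqF.
have n0' : (n%:R : R) != 0 by rewrite pnatr_eq0 -lt0n.
have S0 : (#|{perm 'I_N}|%:R : R) != 0.
  by rewrite pnatr_eq0 -lt0n; apply/card_gt0P; exists 1%g.
pose S i := \sum_j \sum_(j' < N | j != j') h (x i j w) (x i j' w).
have Sk i k : \sum_(s : {perm 'I_N}) h (x i (s (a k)) w) (x i (s (b k)) w) =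
    #|{perm 'I_N}|%:R * (N%:R * (N%:R - 1))^-1 * S i.
  have := sum_perm_pair (fun j j' => h (x i j w) (x i j' w)) (ab k).
  have -> : (#|'I_N| `!)%N = #|{perm 'I_N}|.
    by rewrite -card_Sn card_ord.
  rewrite card_ord natrM -subn1 natrB ?(ltnW N1)// => SE.
  by rewrite -mulrA mulrCA -SE mulKf// mulf_neq0.
rewrite exchange_big/=.
under [in RHS]eq_bigr => i _ do
  rewrite exchange_big/= (eq_bigr _ (fun k _ => Sk i k)) sumr_const card_ord.
rewrite sumrMnl -mulr_sumr /Hstar -/S -[X in _ = _ * X]mulr_natl.
by field; rewrite n0' N0 N1' S0.
Qed.

(** * Moment generating function and Chernoff bound for the statistic *)

Section tail.
Context (R : realType) (d : measure_display) (Om : measurableType d)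
  (P : probability Om R) (d' : measure_display) (E : measurableType d')
  (n N : nat) (x : 'I_n -> 'I_N -> {mfun Om >-> E}) (h : E -> E -> R).
Hypothesis mh : measurable_fun [set: E * E] (fun z : E * E => h z.1 z.2).

Lemma measurable_kernel (i : 'I_n) (j j' : 'I_N) :
  measurable_fun setT (fun w => h (x i j w) (x i j' w)).
Proof. exact: (measurableT_comp mh (measurable_pair (x i j) (x i j'))). Qed.

Lemma measurable_Hstar : measurable_fun setT (Hstar x h).
Proof.
apply: measurable_funM => //; apply: measurable_sum => i.
apply: measurable_sum => j; under eq_fun do rewrite -big_filter.
by apply: measurable_sum => j'; exact: measurable_kernel.
Qed.

Lemma measurable_array_row (i : 'I_n) : measurable_fun setT (array_row x i).
Proof.
apply/measurable_fun_tnthP => j; apply: (eq_measurable_fun (x i j)) => //.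
by move=> w _ /=; rewrite tnth_mktuple.
Qed.

(** Independence of rows is applied to functions of whole tuples, then independence of entries
    inside each row. *)
Lemma expectation_prod_rows_pairs (K : finType) (a b : K -> 'I_N)
    (g : 'I_n -> E * E -> R) (M : R) :
  mutually_independent P (array_row x) ->
  (forall i, mutually_independent P (x i)) ->
  injective a -> injective b -> (forall k l, a k != b l) ->
  (forall i, measurable_fun setT (g i)) -> (forall i z, 0 <= g i z <= M) ->
  (\int[P]_w (\prod_i \prod_k g i (x i (a k) w, x i (b k) w))%:E =
   \prod_i \prod_k \int[P]_w (g i (x i (a k) w, x i (b k) w))%:E)%E.
Proof.
move=> hrows hcols aI bI ab mg gM.
pose f i (t : N.-tuple E) := \prod_k g i (tnth t (a k), tnth t (b k)).
transitivity (\int[P]_w (\prod_i f i (array_row x i w))%:E)%E.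
  apply: eq_integral => w _; congr EFin; apply: eq_bigr => i _.
  by apply: eq_bigr => k _; rewrite !tnth_mktuple.
rewrite (@expectation_prod_indep _ _ _ _ _ P measurable _ _ _ _
  (array_row x) f (M ^+ #|K|)).
- apply: eq_bigr => i _; rewrite -(expectation_prod_pairs aI bI ab (hcols i)
    (fun=> mg i) (fun=> gM i)).
  apply: eq_integral => w _; congr EFin.
  by apply: eq_bigr => k _; rewrite !tnth_mktuple.
- by rewrite sigma_algebra_id//; exact: sigma_algebra_measurable.
- by move=> A B; exact: measurableI.
- exact: measurableT.
- exact: measurable_array_row.
- exact: hrows.
- move=> i; apply: measurable_prod => k _.
  apply: (measurableT_comp (mg i)).
  by apply: measurable_fun_pair; exact: measurable_tnth.
- move=> i y; rewrite prodr_ge0; last first.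
    by move=> k _; case/andP: (gM i (tnth y (a k), tnth y (b k))).
  by rewrite /= -prodr_const; apply: ler_prod => k _; exact: gM.
Qed.

Variables (b l t : R) (hN : (1 < N)%N).
Hypotheses (n0 : (0 < n)%N) (hb : forall y z, `|h y z| <= b).
Hypotheses (l0 : 0 < l) (lb : l * (2 * b) < 3).
Hypothesis hrows : mutually_independent P (array_row x).
Hypothesis hcols : forall i, mutually_independent P (x i).
Hypothesis hid : forall i, identically_distributed P (x i).

Let m := N./2.
Let K := 2 * (1 - l * (2 * b) / 3).
Let mean i := fine 'E_P[h_first_two x h hN i].

(** The factor [n%:R * m%:R] turns the mean attached to each permutation into a plain sum, so that
    every summand carries the exponent [l]. *)
Lemma Hstar_mgf_le :
  (\int[P]_w (expR (l * (n%:R * m%:R) * (Hstar x h w - theta P x h hN)))%:E <=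
   (expR (n%:R * m%:R * (l ^+ 2 * sigma2 P x h hN / K)))%:E)%E.
Proof.
have m2 k : (k < m -> k.*2.+1 < N)%N by rewrite /m; lia.
(* When [N] is odd, one column is left unpaired under each permutation. *)
pose ev (k : 'I_m) : 'I_N := Ordinal (ltnW (m2 _ (ltn_ord k))).
pose od (k : 'I_m) : 'I_N := Ordinal (m2 _ (ltn_ord k)).
have evI : injective ev.
  by move=> k k' /(congr1 val)/= kk'; apply: val_inj => /=; lia.
have odI : injective od.
  by move=> k k' /(congr1 val)/= kk'; apply: val_inj => /=; lia.
have evod k k' : ev k != od k'.
  by apply/eqP => /(congr1 val)/=; lia.
have mfirst i : measurable_fun setT (h_first_two x h hN i).
  exact: measurable_kernel.
have hfirst i w : `|h_first_two x h hN i w| <= b by exact: hb.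
have n0' : (n%:R : R) != 0 by rewrite pnatr_eq0 -lt0n.
have K0 : K != 0 by rewrite gt_eqF// /K mulr_gt0// subr_gt0 ltr_pdivrMr// mul1r.
have S0 : (0 < #|{perm 'I_N}|)%N by apply/card_gt0P; exists 1%g.
pose g i (z : E * E) := expR (l * (h z.1 z.2 - mean i)).
have mg i : measurable_fun setT (g i).
  apply: measurableT_comp => //; apply: measurable_funM => //.
  exact: measurable_funB.
have gM i z : 0 <= g i z <= expR (l * (2 * b)).
  rewrite expR_ge0/= ler_expR; apply: ler_wpM2l; first exact: ltW.
  rewrite (le_trans (ler_norm _))//.
  rewrite (le_trans (ler_normB _ _))// mulr_natl mulr2n lerD//.
  exact: norm_expectation_le.
have pointwise w : expR (l * (n%:R * m%:R) * (Hstar x h w - theta P x h hN)) <=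
    #|{perm 'I_N}|%:R^-1 * \sum_(s : {perm 'I_N})
      \prod_i \prod_k g i (x i (s (ev k)) w, x i (s (od k)) w).
  apply: le_trans (le_trans (expR_mean_le
    (fun s : {perm 'I_N} => l * \sum_i \sum_k
      (h (x i (s (ev k)) w) (x i (s (od k)) w) - mean i)) S0) _).
    rewrite ler_expR -mulr_sumr [leRHS]mulrCA -[leLHS]mulrA ler_pM2l//.
    rewrite mulrBr (Hstar_perm_mean x h w n0 hN (fun k => evod k k)).
    rewrite le_eqVlt; apply/orP; left; apply/eqP.
    (* Row means may differ, but each is subtracted [m] times, for a total of [n * m] times
       [theta]. *)
    have centered (s : {perm 'I_N}) :
        \sum_i \sum_k (h (x i (s (ev k)) w) (x i (s (od k)) w) - mean i) =
        \sum_i \sum_k h (x i (s (ev k)) w) (x i (s (od k)) w) -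
        n%:R * m%:R * theta P x h hN.
      under eq_bigr => i _ do rewrite sumrB sumr_const card_ord.
      rewrite sumrB sumrMnl /theta; congr (_ - _).
      by rewrite -[LHS]mulr_natl; field.
    under [in RHS]eq_bigr do rewrite centered.
    rewrite sumrB sumr_const mulrBr -[X in _ = _ - _ * X]mulr_natl mulKf//.
    by rewrite pnatr_eq0 -lt0n.
  rewrite ler_wpM2l ?invr_ge0// ler_sum// => s _.
  rewrite mulr_sumr expR_sum ler_prod// => i _.
  by rewrite expR_ge0 mulr_sumr expR_sum lexx.
have mF (s : {perm 'I_N}) : measurable_fun setT
    (fun w => \prod_i \prod_k g i (x i (s (ev k)) w, x i (s (od k)) w)).
  apply: measurable_prod => i _; apply: measurable_prod => k _.
  by apply: (measurableT_comp (mg i)); exact: measurable_pair.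
have F0 (s : {perm 'I_N}) w :
    0 <= \prod_i \prod_k g i (x i (s (ev k)) w, x i (s (od k)) w).
  by apply: prodr_ge0 => i _; apply: prodr_ge0 => k _; exact: expR_ge0.
have intF (s : {perm 'I_N}) :
    (\int[P]_w (\prod_i \prod_k g i (x i (s (ev k)) w, x i (s (od k)) w))%:E <=
     (expR (n%:R * m%:R * (l ^+ 2 * sigma2 P x h hN / K)))%:E)%E.
  rewrite (@expectation_prod_rows_pairs _ (s \o ev) (s \o od) g
    (expR (l * (2 * b))))//; last 3 first.
  - by move=> k k' /perm_inj /evI.
  - by move=> k k' /perm_inj /odI.
  - by move=> k k'; rewrite /= (inj_eq perm_inj).
  apply: (@le_trans _ _ (\prod_i \prod_(k < m)
      (expR (l ^+ 2 * fine 'V_P[h_first_two x h hN i] / K))%:E)%E).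
    apply: lee_prod => i; apply/andP; split.
      apply: prode_ge0 => k _; apply: integral_ge0 => w _.
      by rewrite lee_fin expR_ge0.
    apply: lee_prod => k; apply/andP; split.
      by apply: integral_ge0 => w _; rewrite lee_fin expR_ge0.
    rewrite (@eq_expectation_pair _ _ _ _ _ P _ (x i) _ _
      (Ordinal (ltnW hN)) (Ordinal hN))//.
    - by apply: bernstein_mgf => //; [exact: mfirst|exact: ltW].
    - by rewrite /= (inj_eq perm_inj).
    - by move=> z; exact: expR_ge0.
  under eq_bigr do rewrite prodEFin -expR_sum.
  rewrite prodEFin -expR_sum lee_fin ler_expR.
  rewrite le_eqVlt; apply/orP; left; apply/eqP.
  under eq_bigr do rewrite sumr_const card_ord.
  rewrite sumrMnl -mulr_suml -mulr_sumr /sigma2 -[LHS]mulr_natl.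
  by field; rewrite n0' K0.
apply: (@le_trans _ _ (\int[P]_w (#|{perm 'I_N}|%:R^-1%:E *
    \sum_(s : {perm 'I_N})
    (\prod_i \prod_k g i (x i (s (ev k)) w, x i (s (od k)) w))%:E))%E).
  apply: ge0_le_integral => //.
  - apply/measurable_EFinP; apply: measurableT_comp => //.
    apply: measurable_funM => //; apply: measurable_funB => //.
    exact: measurable_Hstar.
  - apply: measurable_funeM; apply: emeasurable_sum => s.
    exact/measurable_EFinP.
  - by move=> w _; rewrite sumEFin -EFinM lee_fin.
rewrite ge0_integralZl//; last 2 first.
- by apply: emeasurable_sum => s; exact/measurable_EFinP.
- by move=> w _; apply: sume_ge0 => s _; rewrite lee_fin.
rewrite ge0_integral_sum//; last 2 first.
- by move=> s; exact/measurable_EFinP.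
- by move=> s w _; rewrite lee_fin.
rewrite lee_pdivrMl ?ltr0n//.
apply: (le_trans (lee_sum _ (fun s _ => intF s))).
by rewrite sumEFin -EFinM lee_fin sumr_const -[leLHS]mulr_natl.
Qed.

Lemma Hstar_upper_tail :
  (P [set w | (t <= Hstar x h w - theta P x h hN)%R] <=
   (expR (- (n%:R * m%:R * (l * t - l ^+ 2 * sigma2 P x h hN / K))))%:E)%E.
Proof.
have m0 : (0 < m)%N by rewrite /m; lia.
have r0 : 0 < l * (n%:R * m%:R) by rewrite !mulr_gt0// ltr0n.
have mD : measurable_fun setT (Hstar x h \- cst (theta P x h hN)).
  by apply: measurable_funB => //; exact: measurable_Hstar.
pose D : {mfun Om >-> R} := HB.pack (Hstar x h \- cst (theta P x h hN))
  (isMeasurableFun.Build _ _ _ _ _ mD).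
rewrite -[X in P X]/[set w | (D w >= t)%R].
refine (le_trans (@chernoff _ _ _ P D _ t r0) _).
rewrite /mmt_gen_fun expectation.unlock.
apply: (@le_trans _ _
  ((expR (n%:R * m%:R * (l ^+ 2 * sigma2 P x h hN / K)))%:E *
  (expR (- (l * (n%:R * m%:R) * t)))%:E)%E).
  rewrite lee_wpmul2r ?lee_fin ?expR_ge0//; apply: le_trans Hstar_mgf_le.
  by under eq_integral do rewrite /= mulrC.
rewrite -EFinM -expRD lee_fin ler_expR le_eqVlt; apply/orP; left; apply/eqP.
ring.
Qed.

End tail.

(** * One-sided deviation at the stated radius *)

Section reduction.
Context (R : realType) (d : measure_display) (Om : measurableType d)
  (P : probability Om R) (d' : measure_display) (E : measurableType d')
  (n N : nat) (x : 'I_n -> 'I_N -> {mfun Om >-> E}) (hN : (1 < N)%N).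

(** The radius of the theorem, with [L] for [ln (2 / delta)]. *)
Definition deviation (h : E -> E -> R) (b L : R) : R :=
  2 * Num.sqrt (sigma2 P x h hN) * Num.sqrt (2 * L / (n%:R * N%:R)) +
  16 * b * L / (3 * n%:R * N%:R).

Lemma sigma2_ge0 (h : E -> E -> R) : 0 <= sigma2 P x h hN.
Proof.
rewrite mulr_ge0 ?invr_ge0// sumr_ge0// => i _.
exact/fine_ge0/variance_ge0.
Qed.

Lemma HstarN (h : E -> E -> R) w :
  Hstar x (fun y z => - h y z) w = - Hstar x h w.
Proof.
rewrite /Hstar -mulrN -sumrN; congr (_ * _); apply: eq_bigr => i _.
by rewrite -sumrN; apply: eq_bigr => j _; rewrite -sumrN.
Qed.

Lemma fine_expectationN (Y : Om -> R) : Y \in Lfun P 1 ->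
  fine 'E_P[fun w => - Y w] = - fine 'E_P[Y].
Proof.
move=> Y1; rewrite (_ : (fun w => _) = -1 \o* Y); last first.
  by apply/funext => w /=; rewrite mulrN1.
by rewrite expectationZl// fineM ?expectation_fin_num//= mulN1r.
Qed.

Lemma varianceN_Lfun1 (Y : Om -> R) : Y \in Lfun P 1 ->
  'V_P[(fun w => - Y w)%R]%E = 'V_P[Y]%E.
Proof.
move=> Y1; rewrite /variance covariance.unlock fine_expectationN//.
congr expectation; apply/funext => w.
rewrite -[LHS]/((- Y w - - fine 'E_P[Y]) * (- Y w - - fine 'E_P[Y])).
by rewrite -[RHS]/((Y w - fine 'E_P[Y]) * (Y w - fine 'E_P[Y])); ring.
Qed.

Lemma eq_ae_expectation (Y Y' : Om -> R) : measurable_fun setT Y ->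
  measurable_fun setT Y' -> {ae P, forall w, Y w = Y' w} ->
  'E_P[Y]%E = 'E_P[Y']%E.
Proof.
move=> mY mY' YY'; rewrite unlock; apply: ae_eq_integral => //.
- exact/measurable_EFinP.
- exact/measurable_EFinP.
- by apply: filterS YY' => w ->.
Qed.

Lemma eq_ae_variance (Y Y' : Om -> R) : measurable_fun setT Y ->
  measurable_fun setT Y' -> {ae P, forall w, Y w = Y' w} ->
  'V_P[Y]%E = 'V_P[Y']%E.
Proof.
move=> mY mY' YY'; rewrite /variance covariance.unlock.
rewrite (eq_ae_expectation mY mY' YY'); apply: eq_ae_expectation.
- by apply: measurable_funM; exact: measurable_funB.
- by apply: measurable_funM; exact: measurable_funB.
- apply: filterS YY' => w YY'w.
  rewrite -[LHS]/((Y w - fine 'E_P[Y']) * (Y w - fine 'E_P[Y'])) YY'w.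
  by [].
Qed.

Hypothesis n0 : (0 < n)%N.
Hypothesis hrows : mutually_independent P (array_row x).
Hypothesis hcols : forall i, mutually_independent P (x i).
Hypothesis hid : forall i, identically_distributed P (x i).

Lemma Hstar_upper_deviation (h : E -> E -> R) (b L : R) :
  measurable_fun setT (fun z : E * E => h z.1 z.2) -> 0 < b -> 0 < L ->
  (forall y z, `|h y z| <= b) ->
  (P [set w | (deviation h b L <= Hstar x h w - theta P x h hN)%R] <=
   (expR (- L))%:E)%E.
Proof.
move=> mh b0 L0 hb.
have nN0 : 0 < n%:R * N%:R :> R by rewrite mulr_gt0 ?ltr0n// ltnW.
pose r := Num.sqrt (L / (n%:R * N%:R)).
have r2 : r ^+ 2 = L / (n%:R * N%:R) by rewrite sqr_sqrtr// ltW// divr_gt0.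
have r0 : 0 < r by rewrite sqrtr_gt0 divr_gt0.
have s0 : 0 <= Num.sqrt (sigma2 P x h hN) by exact: sqrtr_ge0.
have sqrt2 : 7 / 5 <= Num.sqrt 2 :> R.
  rewrite -[leLHS]ger0_norm -?sqrtr_sqr; last lra.
  rewrite ler_sqrt; lra.
(* With [c = 2 * b] the linear terms agree exactly, as 8 / 3 times 2 is 16 / 3; the only loss is 7 /
   5 for sqrt 2. *)
have dev_ge : 14 / 5 * Num.sqrt (sigma2 P x h hN) * r +
    8 / 3 * (2 * b) * r ^+ 2 <= deviation h b L.
  have -> : deviation h b L = 2 * Num.sqrt 2 * Num.sqrt (sigma2 P x h hN) * r +
      16 * b * L / (3 * n%:R * N%:R).
    rewrite /deviation -[2 * L / _]mulrA (@sqrtrM _ 2)// -/r; congr (_ + _).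
    by rewrite mulrA; congr (_ * _); exact: mulrAC.
  apply: lerD; first by rewrite !ler_wpM2r ?(ltW r0)//; lra.
  rewrite r2 le_eqVlt; apply/orP; left; apply/eqP; field.
  by rewrite !pnatr_eq0 -!lt0n n0 ltnW.
have b2 : 0 < 2 * b by rewrite mulr_gt0.
have [] := bernstein_exponent_ge b2 r0 s0 dev_ge.
set l := _ / (_ + _) => l0 lb.
rewrite (sqr_sqrtr (sigma2_ge0 h)) => lr.
apply: (le_trans (@Hstar_upper_tail _ _ _ P _ _ _ _ x h mh b l _ hN n0 hb l0 lb
  hrows hcols hid)).
rewrite lee_fin ler_expR lerN2 (le_trans _ (ler_wpM2l _ lr))//.
rewrite r2 (_ : _ * (3 * _) = (3 * (N./2)%:R / N%:R) * L); last first.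
  by field; rewrite !pnatr_eq0 -!lt0n n0 ltnW.
(* What remains is [N <= 3 * N./2], with equality at [N = 3]. *)
apply: ler_peMl; first exact: ltW.
rewrite ler_pdivlMr ?ltr0n ?(ltnW hN)// mul1r -natrM ler_nat.
by lia.
Qed.

End reduction.

(** * Two-sided bound and truncation *)

Section main.
Context (R : realType) (d : measure_display) (Om : measurableType d)
  (P : probability Om R) (d' : measure_display) (E : measurableType d')
  (n N : nat) (x : 'I_n -> 'I_N -> {mfun Om >-> E}) (hN : (1 < N)%N).
Hypothesis n0 : (0 < n)%N.
Hypothesis hrows : mutually_independent P (array_row x).
Hypothesis hcols : forall i, mutually_independent P (x i).
Hypothesis hid : forall i, identically_distributed P (x i).

Lemma measurable_first_two (h : E -> E -> R) (i : 'I_n) :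
  measurable_fun setT (fun z : E * E => h z.1 z.2) ->
  measurable_fun setT (h_first_two x h hN i).
Proof.
move=> mh.
exact: (measurable_kernel x mh i (Ordinal (ltnW hN)) (Ordinal hN)).
Qed.

Lemma measurable_deviation_event (h : E -> E -> R) (c t : R) :
  measurable_fun setT (fun z : E * E => h z.1 z.2) ->
  measurable [set w | (`|Hstar x h w - c| <= t)%R].
Proof.
move=> mh; have mf : measurable_fun setT (fun w => `|Hstar x h w - c|).
  apply: measurableT_comp => //; apply: measurable_funB => //.
  exact: measurable_Hstar.
rewrite (_ : [set w | _] = (fun w => `|Hstar x h w - c|) @^-1` `]-oo, t]).
  by rewrite -[_ @^-1` _]setTI; exact: mf.
by apply/seteqP; split => w /=; rewrite in_itv.
Qed.

Lemma Hstar_deviation_bounded (h : E -> E -> R) (b L : R) :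
  measurable_fun setT (fun z : E * E => h z.1 z.2) -> 0 < b -> 0 < L ->
  (forall y z, `|h y z| <= b) ->
  ((1 - 2 * expR (- L))%:E <=
   P [set w | (`|Hstar x h w - theta P x h hN| <= deviation P x hN h b L)%R])%E.
Proof.
move=> mh b0 L0 hb.
have h1 i : h_first_two x h hN i \in Lfun P 1.
  apply: (@Lfun1_bounded _ _ _ _ _ b) => [|w]; last exact: hb.
  exact: measurable_first_two.
pose h' y z := - h y z.
have mh' : measurable_fun setT (fun z : E * E => h' z.1 z.2).
  exact: measurableT_comp.
have thetaN : theta P x h' hN = - theta P x h hN.
  rewrite /theta -mulrN -sumrN; congr (_ * _); apply: eq_bigr => i _.
  exact: (fine_expectationN (h1 i)).
have devN : deviation P x hN h' b L = deviation P x hN h b L.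
  rewrite /deviation; congr (_ * Num.sqrt _ * _ + _).
  rewrite /sigma2; congr (_ * _); apply: eq_bigr => i _.
  by congr fine; exact: (varianceN_Lfun1 (h1 i)).
pose U g :=
  [set w | (deviation P x hN g b L <= Hstar x g w - theta P x g hN)%R].
have mU g : measurable_fun setT (fun z : E * E => g z.1 z.2) ->
    measurable (U g).
  move=> mg; have mf : measurable_fun setT
      (fun w => Hstar x g w - theta P x g hN).
    by apply: measurable_funB => //; exact: measurable_Hstar.
  rewrite (_ : U g = (fun w => Hstar x g w - theta P x g hN) @^-1`
                     `[deviation P x hN g b L, +oo[).
    by rewrite -[_ @^-1` _]setTI; exact: mf.
  by apply/seteqP; split => w /=; rewrite in_itv/= andbT.
have upper : (P (U h) <= (expR (- L))%:E)%E by exact: Hstar_upper_deviation.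
have lower : (P (U h') <= (expR (- L))%:E)%E.
  by apply: Hstar_upper_deviation => // y z; rewrite normrN.
set A := [set w | _].
have mA : measurable A by exact: measurable_deviation_event.
have PAC : (P (~` A) <= (2 * expR (- L))%:E)%E.
  apply: (@le_trans _ _ (P (U h `|` U h'))); last first.
    apply: (le_trans (measureU2 _ (mU _ mh) (mU _ mh'))).
    by rewrite mulr_natl mulr2n EFinD leeD.
  apply: le_measure; rewrite ?inE; first exact: measurableC.
    by apply: measurableU; exact: mU.
  move=> w /negP; rewrite -ltNge ltr_normr.
  move=> /orP[] /ltW devw; [by left|right].
  by rewrite /U/= devN thetaN HstarN -opprD.
move: PAC; rewrite probability_setC// leeBlDr ?fin_num_measure//.
by rewrite EFinB leeBlDr// addeC.
Qed.

Lemma Hstar_deviation (h : E -> E -> R) (b L : R) :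
  measurable_fun setT (fun z : E * E => h z.1 z.2) -> 0 < b -> 0 < L ->
  {ae P, forall w, forall i j j', j != j' -> `|h (x i j w) (x i j' w)| <= b} ->
  ((1 - 2 * expR (- L))%:E <=
   P [set w | (`|Hstar x h w - theta P x h hN| <= deviation P x hN h b L)%R])%E.
Proof.
move=> mh b0 L0 hb.
pose h' y z := Num.max (- b) (Num.min b (h y z)).
have mh' : measurable_fun setT (fun z : E * E => h' z.1 z.2).
  by apply: measurable_maxr => //; exact: measurable_minr.
have h'b y z : `|h' y z| <= b.
  by rewrite ler_norml le_max lexx/= ge_max ge_min lexx/= andbT; lra.
have h'E y z : `|h y z| <= b -> h' y z = h y z.
  rewrite ler_norml => /andP[bh hb'].
  by rewrite /h' (min_idPr hb') (max_idPr bh).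
have first_ae i :
    {ae P, forall w, h_first_two x h hN i w = h_first_two x h' hN i w}.
  by apply: filterS hb => w hbw; rewrite /h_first_two h'E// hbw.
have thetaE : theta P x h hN = theta P x h' hN.
  rewrite /theta; congr (_ * _); apply: eq_bigr => i _; congr fine.
  by apply: eq_ae_expectation => //; exact: measurable_first_two.
have devE : deviation P x hN h b L = deviation P x hN h' b L.
  rewrite /deviation /sigma2; congr (_ * Num.sqrt (_ * _) * _ + _).
  apply: eq_bigr => i _; congr fine.
  by apply: eq_ae_variance => //; exact: measurable_first_two.
rewrite thetaE devE.
have [Z [mZ PZ0 hZ]] := hb.
apply: (le_trans (Hstar_deviation_bounded mh' b0 L0 h'b)).
set A' := [set w | _]; set A := [set w | _].
have mA' : measurable A' by exact: measurable_deviation_event.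
have mA : measurable A by exact: measurable_deviation_event.
(* Off the null set [Z] the statistics of [h] and of its truncation coincide; their means and radii
   were already identified. *)
apply: (@le_trans _ _ (P (A `|` Z))).
  apply: le_measure; rewrite ?inE//; first exact: measurableU.
  move=> w A'w; have [Zw|Zw] := pselect (Z w); [by right|left].
  have hw : forall i j j', j != j' -> `|h (x i j w) (x i j' w)| <= b.
    by apply: contrapT => nhw; apply/Zw/hZ.
  rewrite /A/= (_ : Hstar x h w = Hstar x h' w)//.
  rewrite /Hstar; congr (_ * _); apply: eq_bigr => i _; apply: eq_bigr => j _.
  by apply: eq_bigr => j' jj'; rewrite h'E// hw.
apply: (le_trans (measureU2 _ mA mZ)).
by rewrite [X in (_ + X <= _)%E]PZ0 adde0.
Qed.

End main.

Unset Implicit Arguments.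

Theorem lemma9 (R : realType) (d : measure_display) (Om : measurableType d)
    (P : probability Om R) (d' : measure_display) (E : measurableType d')
    (n N : nat) (hn : (0 < n)%N) (hN : (1 < N)%N)
    (x : 'I_n -> 'I_N -> {mfun Om >-> E})
    (hrows : mutually_independent P (array_row x))
    (hcols : forall i : 'I_n, mutually_independent P (x i))
    (hid : forall i : 'I_n, identically_distributed P (x i))
    (h : E -> E -> R)
    (mh : measurable_fun [set: E * E] (fun z : E * E => h z.1 z.2))
    (b : R) (hb : 0 < b)
    (hbound : {ae P, forall w, forall (i : 'I_n) (j j' : 'I_N), j != j' ->
                 `|h (x i j w) (x i j' w)| <= b})
    (delta : R) (hdelta : 0 < delta < 1) :
  ((1 - delta)%:E <=
     P [set w | (`|Hstar x h w - theta P x h hN| <=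
          2 * Num.sqrt (sigma2 P x h hN)
            * Num.sqrt (2 * ln (2 / delta) / (n%:R * N%:R))
          + 16 * b * ln (2 / delta) / (3 * n%:R * N%:R))%R])%E.
Proof.
have [d0 d1] := andP hdelta.
have L0 : 0 < ln (2 / delta) by rewrite ln_gt0// ltr_pdivlMr//; lra.
(* [ln (2 / delta)] is the [L] at which the two tails together cost [delta]. *)
have -> : 1 - delta = 1 - 2 * expR (- ln (2 / delta)).
  by rewrite expRN lnK ?posrE ?divr_gt0// invf_div; field; lra.
exact: Hstar_deviation.
Qed.
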